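(* Let $n,M$ be positive integers, let $q_1,\dots,q_n\ge0$ be real numbers with $\sum_{j=1}^n q_j=M$, let $0\le\rho\le1$, and put $q_j^\rho=\frac{q_j}{M}(M+2\rho-1)$ for $1\le j\le n$. Let $\varphi:\mathbb R\to\mathbb R$ be a symmetric (i.e. $\varphi(-x)=\varphi(x)$) and strictly convex function with $\varphi(0)=0$ and $\varphi(x)>0$ for all $x>0$. Let $$\psi(\mathbf m)=\sum_{j=1}^n\varphi\big(|m_j-q_j^\rho|\big).$$ Then the algorithm MinimalSolution with the decomposable error function $\psi$ yields the $\rho$-rounding method; that is, the set of seat vectors output by MinimalSolution for $\psi$ is equal to the set of seat vectors produced by the $\rho$-rounding method for the exact quotas $(q_1,\dots,q_n)$.
   Context: $\mathbb N=\{0,1,2,\dots\}$, and $\mathcal M=\{(m_1,\dots,m_n)\in\mathbb Z^n: m_j\ge0,\ \sum_j m_j=M\}$ is the set of possible allocations of $M$ seats to $n$ parties; $q_j$ is the exact quota of party $j$. Decomposable error function: a function $\psi:\mathcal M\to\mathbb R_{\ge0}$ of the form $\psi(\mathbf m)=\sum_{j=1}^n\varphi_j(m_j)$ with $\varphi_j:\mathbb N\to\mathbb R_{\ge0}$ such that $H_j(\ell)=\varphi_j(\ell)-\varphi_j(\ell-1)$, $\ell\ge1$, is (weakly) increasing in $\ell$ for each $j$. Here $\varphi_j(x)=\varphi(|x-q_j^\rho|)$. Algorithm MinimalSolution for $\psi$: it outputs the vectors $\mathbf m\in\mathcal M$ such that the multiset $\{H_j(\ell):1\le\ell\le m_j,\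 1\le j\le n\}$ is the multiset of the $M$ smallest entries, counted with multiplicity, of the $M\times n$ matrix with entry $H_j(\ell)$ in row $\ell$, column $j$ (several output vectors are possible in case of ties). $\rho$-rounding method: let $\mu_j^\rho=\lfloor q_j^\rho\rfloor$, $r_j^\rho=q_j^\rho-\mu_j^\rho$, and $R=M-\sum_{j=1}^n\mu_j^\rho$. One first allocates $\mu_j^\rho$ seats to party $j$. If $R\ge0$, the $R$ remaining seats are given, one each, to $R$ parties with the largest remainders $r_j^\rho$ (ties broken arbitrarily): $m_j=\mu_j^\rho+1$ for $j\in J$ and $m_j=\mu_j^\rho$ for $j\notin J$, where $J\subseteq\{1,\dots,n\}$, $|J|=R$, and $r_j^\rho\ge r_k^\rho$ for all $j\in J$, $k\notin J$. If $R=-1$ (which can only occur when $\rho=1$ and all $q_j^\rho$ are integers), one seat is taken away from one arbitrarily chosen party among those with $\mu_j^\rho>q_j$. The set of seat vectors produced by the method is the set of all $(m_1,\dots,m_n)$ arising from all possible arbitrary choices. *)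

(* Defs.v *)
From HB Require Import structures.
From mathcomp Require Import all_boot all_order all_algebra.
From mathcomp Require Import all_classical all_reals.

Set Implicit Arguments.
Unset Strict Implicit.
Unset Printing Implicit Defensive.

Import Order.TTheory GRing.Theory Num.Theory.

Local Open Scope classical_set_scope.
Local Open Scope ring_scope.

Definition strictly_convex (R : realType) (f : R -> R) : Prop :=
  forall x y t : R, x != y -> 0 < t < 1 ->
    f (t * x + (1 - t) * y) < t * f x + (1 - t) * f y.

Definition allocations (n M : nat) : set {ffun 'I_n -> nat} :=
  [set m | (\sum_j m j = M)%N].

(* Only meaningful for 1 <= l. *)
Definition increment (R : realType) (n : nat) (phi_ : 'I_n -> nat -> R)
    (j : 'I_n) (l : nat) : R :=
  phi_ j l - phi_ j l.-1.

(* The values of psi off [allocations M] are irrelevant. *)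
Definition decomposable_error (R : realType) (n M : nat)
    (phi_ : 'I_n -> nat -> R) (psi : {ffun 'I_n -> nat} -> R) : Prop :=
  [/\ forall m, allocations M m -> psi m = \sum_j phi_ j (m j),
      forall j l, 0 <= phi_ j l
    & forall j k l, (1 <= k <= l)%N ->
        increment phi_ j k <= increment phi_ j l].

(* The rows l = 1, ..., M are numbered from 0. *)
Definition increment_matrix (R : realType) (n M : nat)
    (phi_ : 'I_n -> nat -> R) : 'M[R]_(M, n) :=
  \matrix_(i < M, j < n) increment phi_ j i.+1.

Definition smallest_entries (R : realType) (n M : nat)
    (A : 'M[R]_(M, n)) : seq R :=
  take M (sort <=%R [seq A i j | i <- enum 'I_M, j <- enum 'I_n]).

(* Sequences up to [perm_eq] play the role of multisets. *)
Definition minimal_solution (R : realType) (n M : nat)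
    (phi_ : 'I_n -> nat -> R) : set {ffun 'I_n -> nat} :=
  [set m | allocations M m /\
     perm_eq [seq increment phi_ j l | j <- enum 'I_n, l <- iota 1 (m j)]
             (smallest_entries (increment_matrix M phi_))].

Section RhoRounding.

Variables (R : realType) (n M : nat) (q : 'I_n -> R) (rho : R).

Definition rho_quota (j : 'I_n) : R :=
  q j / M%:R * (M%:R + 2 * rho - 1).

Definition rho_floor (j : 'I_n) : int := Num.floor (rho_quota j).

Definition rho_remainder (j : 'I_n) : R := rho_quota j - (rho_floor j)%:~R.

Definition remaining_seats : int := M%:Z - \sum_j rho_floor j.

Definition rho_rounding : set {ffun 'I_n -> nat} :=
  [set m |
     (0 <= remaining_seats /\
      exists J : {set 'I_n},
        [/\ #|J|%:Z = remaining_seats,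
            forall j k, j \in J -> k \notin J ->
              rho_remainder k <= rho_remainder j
          & forall j, (m j)%:Z = rho_floor j + (j \in J)%:Z])
     \/
     (remaining_seats = -1 /\
      exists i : 'I_n,
        q i < (rho_floor i)%:~R /\
        forall j, (m j)%:Z = rho_floor j - (j == i)%:Z)].

End RhoRounding.

(* Main.v *)
(* A vector m with sum M is a minimal solution iff no exchange of one seat
   pays off, i.e. H_j(m_j) <= H_k(m_k + 1) whenever m_j > 0. Strict convexity
   makes phi x - phi (x - 1) strictly increasing in x, so that this condition
   becomes m_j - q_j^rho <= m_k + 1 - q_k^rho, independently of phi. Writing
   e_j = m_j - floor q_j^rho, an e_j >= 2 would force all e_k >= 1 and an
   e_k < 0 would force all e_j <= 0; since the e_j add up to R, where
   -1 <= R <= n, they are the indicator of a set of parties with the R largest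
   remainders or, for R = -1, minus the indicator of a single party. *)

Require Import Defs.
From HB Require Import structures.
From mathcomp Require Import all_boot all_order all_algebra.
From mathcomp Require Import all_classical all_reals.
From mathcomp Require Import ring lra zify.

Import Order.TTheory GRing.Theory Num.Theory.

Local Open Scope classical_set_scope.
Local Open Scope ring_scope.

(** * Smallest entries and the exchange condition *)

Lemma perm_take_sort (d : Order.disp_t) (T : orderType d) (s A B : seq T) :
  perm_eq s (A ++ B) ->
  perm_eq A (take (size A) (sort <=%O s)) = allrel <=%O A B.
Proof.
move=> sAB; apply/idP/idP => [permA|leAB].
  (* Cancelling [A] from [s] identifies [B] with the tail of the sorted list, and in a sorted list
     every entry of the head is below every entry of the tail. *)
  have permB : perm_eq B (drop (size A) (sort <=%O s)).
    rewrite -(perm_cat2l A) -(permPl sAB) perm_sym.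
    rewrite (permPl (perm_cat permA (perm_refl _))) cat_take_drop.
    exact/permPl/perm_sort.
  have := sort_le_sorted s.
  rewrite -{1}(cat_take_drop (size A) (sort <=%O s)) le_sorted_pairwise.
  rewrite pairwise_cat => /andP[leTD _].
  rewrite (eq_allrel_meml _ _ (perm_mem permA)).
  by rewrite (eq_allrel_memr _ _ (perm_mem permB)).
(* The concatenation of the two sorted lists is itself sorted, and the sorted rearrangement of [s]
   is unique. *)
have -> : sort <=%O s = sort <=%O A ++ sort <=%O B.
  apply: le_sorted_eq; first exact: sort_le_sorted.
    rewrite le_sorted_pairwise pairwise_cat -!le_sorted_pairwise.
    rewrite !sort_le_sorted !andbT.
    rewrite (eq_allrel_meml _ _ (mem_sort _ _)).
    by rewrite (eq_allrel_memr _ _ (mem_sort _ _)).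
  by rewrite perm_sort (permPl sAB) perm_sym; apply: perm_cat;
    rewrite perm_sort.
by rewrite take_size_cat ?size_sort // perm_sym perm_sort.
Qed.

Lemma perm_allpairs_swap (S T U : eqType) (f : S -> T -> U) (s : seq S)
    (t : seq T) :
  uniq s -> uniq t ->
  perm_eq [seq f x y | x <- s, y <- t] [seq f x y | y <- t, x <- s].
Proof.
(* Values of [f] may repeat, so duplicate-free lists of pairs are compared first and then mapped
   through [g]. *)
move=> us ut; pose g (p : S * T) := f p.1 p.2.
have -> : [seq f x y | x <- s, y <- t] = map g [seq (x, y) | x <- s, y <- t].
  by rewrite map_allpairs.
have -> : [seq f x y | y <- t, x <- s] = map g [seq (x, y) | y <- t, x <- s].
  by rewrite map_allpairs.
apply/perm_map/uniq_perm.
- by apply: allpairs_uniq => // -[? ?] [? ?].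
- by apply: allpairs_uniq => // -[? ?] [? ?] _ _ [-> ->].
case=> x y; apply/allpairsP/allpairsP => -[[a b]] /= [? ? [-> ->]].
  by exists (b, a).
by exists (b, a).
Qed.

Lemma perm_increment_matrix (R : realType) (n M : nat)
    (phi_ : 'I_n -> nat -> R) (m : 'I_n -> nat) :
  (forall j, m j <= M)%N ->
  perm_eq [seq increment_matrix M phi_ i j | i <- enum 'I_M, j <- enum 'I_n]
    ([seq increment phi_ j l | j <- enum 'I_n, l <- iota 1 (m j)] ++
     [seq increment phi_ j l |
        j <- enum 'I_n, l <- iota (m j).+1 (M - m j)]).
Proof.
move=> mM; rewrite perm_sym -perm_allpairs_catr perm_sym.
rewrite (permPl (perm_allpairs_swap _ _ _ _ _ _ _ _)) ?enum_uniq //.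
have -> : [seq increment_matrix M phi_ i j | j <- enum 'I_n, i <- enum 'I_M]
  = [seq increment phi_ j l | j <- enum 'I_n, l <- iota 1 M].
  congr flatten; apply: eq_map => j.
  rewrite -[1%N]/(1 + 0)%N iotaDl -val_enum_ord -!map_comp.
  by apply: eq_map => i; rewrite /= mxE.
apply: perm_allpairs_dep => // j _.
by rewrite -[(m j).+1]/(1 + m j)%N -iotaD subnKC.
Qed.

(** Being minimal means that each chosen entry is at most each rejected one. As columns increase, it
    suffices to compare the last chosen entry of one column with the first rejected entry of
    another. *)
Lemma minimal_solutionP (R : realType) (n M : nat) (phi_ : 'I_n -> nat -> R)
    (m : {ffun 'I_n -> nat}) :
  (forall j k l, (1 <= k <= l)%N ->
     increment phi_ j k <= increment phi_ j l) ->
  minimal_solution M phi_ m <->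
  (\sum_j m j = M)%N /\
  forall j k, (0 < m j)%N ->
    increment phi_ j (m j) <= increment phi_ k (m k).+1.
Proof.
move=> Hmono; rewrite /minimal_solution /allocations /=.
split=> -[sm H]; split=> //.
all: have mM j : (m j <= M)%N by rewrite -sm (bigD1 j) //= leq_addr.
all: pose A := [seq increment phi_ j l | j <- enum 'I_n, l <- iota 1 (m j)].
all: have szA : size A = M.
1,3: rewrite /A size_allpairs_dep -sm sumnE big_map big_enum /=.
1,2: by apply: eq_bigr => j _; rewrite size_iota.
all: have := perm_take_sort _ _ _ _ _ (perm_increment_matrix _ _ _ phi_ m mM).
all: rewrite -/A szA.
  rewrite [perm_eq _ _]H => /esym/allrelP leAB j k mj.
  have [mk|] := ltnP (m k) M.
    apply: leAB; apply/allpairsPdep.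
      by exists j, (m j); rewrite mem_enum mem_iota; split=> //; lia.
    by exists k, (m k).+1; rewrite mem_enum mem_iota; split=> //; lia.
  (* Here row [(m k).+1] lies outside the matrix. But then [k] holds all [M] seats, so [0 < m j]
     forces [j = k]. *)
  move=> Mk; have [->|kj] := eqVneq k j; first by apply: Hmono; lia.
  move: sm; rewrite (bigD1 k) //= (bigD1 j) 1?eq_sym //=; lia.
rewrite /smallest_entries -/A => ->.
apply/allrelP => _ _ /allpairsPdep[j [l [_ + ->]]] /allpairsPdep[k [l' [_ + ->]]].
rewrite !mem_iota => jl kl.
apply: (@le_trans _ _ (increment phi_ j (m j))); first by apply: Hmono; lia.
apply: (@le_trans _ _ (increment phi_ k (m k).+1)); last by apply: Hmono; lia.
by apply: H; lia.
Qed.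

(** * Increments of a strictly convex function *)

Lemma strictly_convex_increment (R : realType) (f : R -> R) (x y : R) :
  strictly_convex f -> x < y -> f x - f (x - 1) < f y - f (y - 1).
Proof.
(* With this weight, [x] is [t * (x - 1) + (1 - t) * y], and [y - 1] is the combination with swapped
   weights. Adding the two convexity inequalities gives [f x + f (y - 1) < f (x - 1) + f y]. *)
move=> fc xy; pose t := (y - x) / (y - x + 1).
have d_gt0 : 0 < y - x + 1 by lra.
have t01 : 0 < t < 1.
  by rewrite divr_gt0 ?subr_gt0 //= ltr_pdivrMr //; lra.
have t01' : 0 < 1 - t < 1 by lra.
have neq : x - 1 != y by apply/eqP; lra.
have := fc _ _ _ neq t01; have := fc _ _ _ neq t01'.
have -> : t * (x - 1) + (1 - t) * y = x by rewrite /t; field; lra.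
have -> : (1 - t) * (x - 1) + (1 - (1 - t)) * y = y - 1.
  by rewrite /t; field; lra.
lra.
Qed.

Lemma le_strictly_convex_increment (R : realType) (f : R -> R) (x y : R) :
  strictly_convex f -> (f x - f (x - 1) <= f y - f (y - 1)) = (x <= y).
Proof.
move=> fc; apply/idP/idP; last first.
  rewrite le_eqVlt => /predU1P[-> //|xy].
  exact/ltW/strictly_convex_increment.
by apply: contraTT; rewrite -!ltNge; exact: strictly_convex_increment.
Qed.

(** Evenness removes the absolute values, even when the quota lies between [l - 1] and [l], so all
    increments become values of one function. Positivity of [l] keeps [l.-1] from truncating. *)
Lemma increment_shift (R : realType) (n : nat) (f : R -> R) (a : 'I_n -> R)
    (j : 'I_n) (l : nat) :
  (forall x, f (- x) = f x) -> (0 < l)%N ->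
  increment (fun j (l : nat) => f `|l%:R - a j|) j l
  = f (l%:R - a j) - f (l%:R - a j - 1).
Proof.
move=> f_even; case: l => // l _.
have f_norm x : f `|x| = f x by case: (ler0P x) => _; rewrite ?f_even.
rewrite /increment !f_norm /=; congr (_ - f _).
by rewrite -natr1; ring.
Qed.

Lemma card_sum_mem (T : finType) (A : {set T}) :
  #|A| = (\sum_x (x \in A))%N.
Proof.
by rewrite -sum1_card big_mkcond; apply: eq_bigr => x _; case: ifP.
Qed.

(** * Balanced seat vectors and the rounding method *)

Section Rounding.

Variables (R : realType) (n M : nat) (q : 'I_n -> R) (rho : R).
Hypotheses (n_gt0 : (0 < n)%N) (M_gt0 : (0 < M)%N).
Hypotheses (q_ge0 : forall j, 0 <= q j) (sum_q : \sum_j q j = M%:R).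
Hypothesis rho01 : 0 <= rho <= 1.

Local Notation a := (rho_quota M q rho).
Local Notation mu := (rho_floor M q rho).
Local Notation r := (rho_remainder M q rho).
Local Notation rem := (remaining_seats M q rho).

Lemma rho_quota_ge0 j : 0 <= a j.
Proof.
have : 1 <= M%:R :> R by rewrite ler1n.
by move: rho01 => ? ?; rewrite mulr_ge0 ?divr_ge0 //; lra.
Qed.

Lemma sum_rho_quota : \sum_j a j = M%:R + 2 * rho - 1.
Proof.
rewrite -mulr_suml -mulr_suml sum_q divff ?mul1r //.
by rewrite pnatr_eq0 -lt0n.
Qed.

Lemma rho_floor_ge0 j : 0 <= mu j.
Proof. by rewrite floor_ge0 rho_quota_ge0. Qed.

Lemma rho_remainder_itv j : 0 <= r j < 1.
Proof. by have := floor_itv (a j); rewrite /rho_remainder intrD1; lra. Qed.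

(** Since the remainders lie in [0, 1), this identity yields all the bounds on the number of
    remaining seats. *)
Lemma sum_rho_remainder : \sum_j r j = rem%:~R + 2 * rho - 1.
Proof.
rewrite sumrB sum_rho_quota /remaining_seats rmorphB /= rmorph_sum /=.
by rewrite -pmulrn; ring.
Qed.

Lemma remaining_seats_ge : -1 <= rem.
Proof.
rewrite -(ler_int R); have : 0 <= \sum_j r j.
  by apply: sumr_ge0 => j _; case/andP: (rho_remainder_itv j).
rewrite sum_rho_remainder; move: rho01; lra.
Qed.

Lemma remaining_seats_le : rem <= n%:Z.
Proof.
have : \sum_j r j < \sum_(j < n) 1.
  apply: ltr_sum => [|j _]; last by case/andP: (rho_remainder_itv j).
  by apply/hasP; exists (Ordinal n_gt0); rewrite ?mem_index_enum.
rewrite sum_rho_remainder sumr_const card_ord => remn.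
rewrite -ltzD1 -(ltr_int R) intrD1 -pmulrn; move: rho01; lra.
Qed.

Lemma remaining_seatsN1 : rem = -1 -> rho = 1 /\ forall j, r j = 0.
Proof.
have r_ge0 j : true -> 0 <= r j by case/andP: (rho_remainder_itv j).
move=> remN1; have := sum_rho_remainder; rewrite remN1 => sum_r.
have : 0 <= \sum_j r j by exact: sumr_ge0.
rewrite sum_r => ?.
have rho1 : rho = 1 by move: rho01; lra.
split=> // j; apply: (psumr_eq0P r_ge0) => //.
by rewrite sum_r rho1; lra.
Qed.

Lemma sum_seats_sub_floor (m : 'I_n -> nat) :
  \sum_j ((m j)%:Z - mu j) = rem <-> (\sum_j m j = M)%N.
Proof.
rewrite sumrB -(big_morph Posz PoszD (erefl _)) /remaining_seats.
split=> [/addIr[]//|->//].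
Qed.

(** The exchange condition with [phi] eliminated; both inclusions pass through it. *)
Definition balanced (m : 'I_n -> nat) : Prop :=
  (\sum_j m j = M)%N /\
  forall j k, (0 < m j)%N -> (m j)%:R - a j <= (m k).+1%:R - a k.

(** The condition reads [e j - r j <= e k - r k + 1]. For [e] the indicator of [J], only [j] in [J]
    and [k] outside needs the choice of largest remainders; elsewhere [bound] suffices. In the other
    case all remainders vanish. *)
Lemma rho_rounding_balanced (m : {ffun 'I_n -> nat}) :
  rho_rounding M q rho m -> balanced m.
Proof.
pose e j := (m j)%:Z - mu j.
have subE j : (m j)%:R - a j = (e j)%:~R - r j.
  by rewrite /e /rho_remainder rmorphB /= -pmulrn; ring.
have bound j k : r k - r j < 1.
  by have := rho_remainder_itv j; have := rho_remainder_itv k; lra.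
rewrite /rho_rounding /=; case=> [[_ [J [cardJ leJ mE]]]|[remN1 [i [_ mE]]]].
  have eE j : e j = (j \in J)%:Z by rewrite /e mE; lia.
  split.
    apply/sum_seats_sub_floor; under eq_bigr => j _ do rewrite -/(e j) eE.
    by rewrite -(big_morph Posz PoszD (erefl _)) -cardJ card_sum_mem.
  move=> j k _; rewrite -natr1 addrAC !subE !eE.
  have := bound j k.
  have := leJ j k.
  case: (j \in J); case: (k \in J) => /=; lra.
have [_ r0] := remaining_seatsN1 remN1.
have eE j : e j = - (j == i)%:Z by rewrite /e mE; ring.
split.
  apply/sum_seats_sub_floor; under eq_bigr => j _ do rewrite -/(e j) eE.
  rewrite (bigD1 i) //= eqxx big1 ?remN1 // => j /negPf-> //.
move=> j k _; rewrite -natr1 addrAC !subE !eE !r0.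
by case: (j == i); case: (k == i) => /=; lra.
Qed.

Lemma balanced_rho_rounding (m : {ffun 'I_n -> nat}) :
  balanced m -> rho_rounding M q rho m.
Proof.
case=> sm bal; pose e j := (m j)%:Z - mu j.
have sum_e : \sum_j e j = rem by apply/sum_seats_sub_floor.
have e_bal j k : (0 < m j)%N -> (e j)%:~R - r j <= (e k)%:~R - r k + 1.
  move=> mj; have := bal j k mj.
  rewrite /e /rho_remainder !rmorphB /= -!pmulrn -natr1.
  lra.
have m_pos j : 0 < e j -> (0 < m j)%N.
  by have := rho_floor_ge0 j; rewrite /e; lia.
have e_le0 k : e k < 0 -> forall j, e j <= 0.
  move=> ek j; rewrite leNgt; apply/negP => ej.
  have := e_bal j k (m_pos j ej).
  have := rho_remainder_itv j; have := rho_remainder_itv k.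
  have : (e k)%:~R <= (-1)%:~R :> R by rewrite ler_int; lia.
  have : 1%:~R <= (e j)%:~R :> R by rewrite ler_int; lia.
  rewrite !mulr1z; lra.
have e_le1 j : 0 <= rem -> e j <= 1.
  move=> rem0; rewrite leNgt; apply/negP => ej.
  have e_ge1 k : 1 <= e k.
    suff : 0 < e k by lia.
    rewrite -(ltr_int R).
    have := e_bal j k (m_pos j _).
    have := rho_remainder_itv j; have := rho_remainder_itv k.
    have : 2%:~R <= (e j)%:~R :> R by rewrite ler_int; lia.
    move=> ? ? ? /(_ ltac:(lia)); lra.
  (* All terms [e k - 1] are nonnegative and the one at [j] is at least 1, so [rem - n >= 1],
     against [rem <= n]. *)
  have : e j - 1 <= \sum_k (e k - 1).
    by rewrite (bigD1 j) //= lerDl sumr_ge0 // => k _; rewrite subr_ge0.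
  rewrite sumrB sum_e sumr_const card_ord natz.
  have := remaining_seats_le; lia.
have [rem0|rem_lt0] := leP 0 rem; [left|right].
  have e_ge0 k : 0 <= e k.
    rewrite leNgt; apply/negP => ek.
    suff : \sum_j e j <= e k by rewrite sum_e; lia.
    by rewrite (bigD1 k) //= gerDl sumr_le0 // => j _; exact: e_le0 ek j.
  split=> //; exists [set j | e j == 1]%SET.
  have eE j : e j = (j \in [set j | e j == 1]%SET)%:Z.
    by rewrite inE; have := e_ge0 j; have := e_le1 j rem0; lia.
  split.
  - rewrite -sum_e; under [RHS]eq_bigr => j _ do rewrite eE.
    by rewrite -(big_morph Posz PoszD (erefl _)) -card_sum_mem.
  - move=> j k; rewrite !inE => /eqP ej ek.
    have ek0 : e k = 0 by have := e_ge0 k; have := e_le1 k rem0; lia.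
    have := e_bal j k (m_pos j _); rewrite ej ek0.
    by move=> /(_ isT); lra.
  - by move=> j; rewrite -eE /e; lia.
have remN1 : rem = -1 by have := remaining_seats_ge; lia.
split=> //.
have [i ei] : exists i, e i < 0.
  apply: contrapT => /forallNP e_ge0; move: rem_lt0; rewrite -sum_e ltNge.
  by rewrite sumr_ge0 // => j _; rewrite leNgt; apply/negP.
(* All [e j] are at most 0 and add up to -1, so the negative one at [i] takes up the whole sum. *)
have eE j : e j = - (j == i)%:Z.
  have e0 := e_le0 i ei; have := sum_e; rewrite remN1 (bigD1 i) //=.
  have [->|ji] := eqVneq j i.
    have : \sum_(k | k != i) e k <= 0 by exact: sumr_le0.
    by move: (\sum_(k | k != i) e k) => S; lia.
  have : \sum_(k | k != i) e k <= e j by rewrite (bigD1 j) //= gerDl sumr_le0.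
  by have := e0 j; move: (\sum_(k | k != i) e k) => S; lia.
exists i; split; last by move=> j; rewrite -eE addrC subrK.
(* It remains to show that party [i] was rounded above its exact quota. For [rho = 1] its floor
   equals [q i + q i / M], and [q i > 0] because the floor is [m i + 1]. *)
have [rho1 r0] := remaining_seatsN1 remN1.
have M_gt0' : 0 < M%:R :> R by rewrite ltr0n.
have mu_a : (mu i)%:~R = a i by have := r0 i; rewrite /rho_remainder; lra.
have aE : a i = q i + q i / M%:R.
  by rewrite /rho_quota rho1; field; rewrite gt_eqF.
have a_gt0 : 0 < a i.
  by rewrite -mu_a ltr0z; have := eE i; rewrite /e eqxx; lia.
have q_gt0 : 0 < q i.
  rewrite lt_neqAle q_ge0 andbT; apply/negP => /eqP qi0.
  by move: a_gt0; rewrite aE -qi0 mul0r addr0 ltxx.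
by rewrite mu_a aE ltrDl divr_gt0.
Qed.

End Rounding.

Theorem corollary6p4 (R : realType) (n M : nat) (q : 'I_n -> R) (rho : R)
    (phi : R -> R)
    (n_gt0 : (0 < n)%N) (M_gt0 : (0 < M)%N)
    (q_ge0 : forall j, 0 <= q j) (sum_q : \sum_j q j = M%:R)
    (rho01 : 0 <= rho <= 1)
    (phi_sym : forall x, phi (- x) = phi x)
    (phi_convex : strictly_convex phi)
    (phi0 : phi 0 = 0) (phi_gt0 : forall x, 0 < x -> 0 < phi x) :
  let phi_ (j : 'I_n) (l : nat) := phi `|l%:R - rho_quota M q rho j| in
  let psi (m : {ffun 'I_n -> nat}) :=
    \sum_j phi `|(m j)%:R - rho_quota M q rho j| in
  decomposable_error M phi_ psi /\
  minimal_solution M phi_ = rho_rounding M q rho.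
Proof.
move=> phi_ psi.
(* This equivalence serves twice: within one column it gives monotonicity, across columns it turns
   the exchange condition into [balanced]. *)
have le_incr j k (l l' : nat) : (0 < l)%N -> (0 < l')%N ->
    (increment phi_ j l <= increment phi_ k l') =
    (l%:R - rho_quota M q rho j <= l'%:R - rho_quota M q rho k).
  by move=> l0 l'0; rewrite !increment_shift // le_strictly_convex_increment.
have incr_mono j k l : (1 <= k <= l)%N ->
    increment phi_ j k <= increment phi_ j l.
  by move=> kl; rewrite le_incr ?lerD2r ?ler_nat; lia.
split.
  split=> // j l; rewrite /phi_.
  by have := normr_ge0 (l%:R - rho_quota M q rho j);
    rewrite le_eqVlt => /predU1P[<-|/phi_gt0/ltW//]; rewrite phi0.
have solutionP m : minimal_solution M phi_ m <-> balanced R n M q rho m.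
  rewrite minimal_solutionP // /balanced.
  by split=> -[sm H]; split=> // j k mj; have := H j k mj; rewrite le_incr.
apply/seteqP; split=> m /=.
  move=> /solutionP; exact: balanced_rho_rounding.
by move=> /rho_rounding_balanced bal; apply/solutionP; exact: bal.
Qed.
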